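(* Let $\rho_h$ be a (probabilistically weak) solution, as defined in the context, of the discontinuous Galerkin Dean--Kawasaki scheme. Then the scheme is locally conservative: for any $K\in\mathcal T_h$ and any $t>0$, $$\mathrm d\int_K\rho_h(t,\boldsymbol x)\,\mathrm d\boldsymbol x=-\int_{\partial K}\widehat{\boldsymbol J}_{\mathrm{det}}\cdot\boldsymbol n_K\,\mathrm dS\,\mathrm dt-\int_{\partial K}\mathrm d\widehat{\boldsymbol J}_{\mathrm{stoch}}\cdot\boldsymbol n_K\,\mathrm dS,$$ where, on each facet $F$, the deterministic flux is $\widehat{\boldsymbol J}_{\mathrm{det}}=-\tfrac12\{\!\{\nabla_h\rho_h\}\!\}+\tfrac{\eta}{2h_F}[\![\rho_h]\!]$ and the stochastic flux is $\mathrm d\widehat{\boldsymbol J}_{\mathrm{stoch}}=N^{-1/2}\sum_{j}\{\!\{\boldsymbol g_j(\rho_h)\}\!\}\,\mathrm dB_j$. Here $\boldsymbol g_j$ and the independent standard Brownian motions $B_j$ are those in the definition of the scheme.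
   Context: Let $d\in\{1,2,3\}$, $p\ge1$ an integer, $\mathbb T^d$ the flat torus; $(\cdot,\cdot)$ and $\|\cdot\|$ are the $L^2(\mathbb T^d)$ inner product and norm. $\mathcal T_h$ is a shape-regular, quasi-uniform affine simplicial mesh of $\mathbb T^d$ with facet set $\mathcal F_h$ (all facets interior by periodicity); $h_F>0$ is the diameter of $F$ (for $d=1$, a positive local length scale); $\boldsymbol n_K$ is the outward unit normal of $K$. $V_p$ (resp. $\boldsymbol V_\ell^d$) is the space of $L^2$ functions (resp. $\mathbb R^d$-valued functions) that are polynomials of degree at most $p$ (resp. $\ell$) on each element, without continuity. On $F=\partial K_\ell\cap\partial K_r$: $\{\!\{\boldsymbol v\}\!\}:=\frac12(\boldsymbol v|_{K_\ell}+\boldsymbol v|_{K_r})$, $[\![v]\!]:=v|_{K_\ell}\boldsymbol n_{K_\ell}+v|_{K_r}\boldsymbol n_{K_r}$. Local lifting $\boldsymbol{\mathcal L}_F(\boldsymbol u)\in\boldsymbol V_{p-1}^d$: $\int_{\mathbb T^d}\boldsymbol{\mathcal L}_F(\boldsymbol u)\cdot\boldsymbol v_h=\int_F\{\!\{\boldsymbol v_h\}\!\}\cdot\boldsymbol u\,\mathrm dS$ for all $\boldsymbol v_h\in\boldsymbol V_{p-1}^d$. Discrete gradient $G_hv_h:=\nabla_hv_h-\sum_F\boldsymbol{\mathcal L}_F([\![v_h]\!])$, $\nabla_h$ the elementwise gradient. Symmetric interior penalty form with $\eta>0$: $$a_h(w_h,v_h):=\tfrac12(\nabla_hw_h,\nabla_hv_h)-\tfrac12\sum_{F}\int_F\big([\![w_h]\!]\cdot\{\!\{\nabla_hv_h\}\!\}+\{\!\{\nabla_hw_h\}\!\}\cdot[\![v_h]\!]\big)\mathrm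 dS+\tfrac\eta2\sum_Fh_F^{-1}\int_F[\![w_h]\!]\cdot[\![v_h]\!]\,\mathrm dS.$$ Scheme. Let $n_G:=\dim\boldsymbol V_{p-1}^d$, $\{\boldsymbol f_i\}$ a basis of $\boldsymbol V_{p-1}^d$, $(M_{\mathrm G})_{ij}=(\boldsymbol f_i,\boldsymbol f_j)$, $u_h^+=\max\{u_h,0\}$, $P(u_h)_{ij}=\int u_h^+\boldsymbol f_i\cdot\boldsymbol f_j$, $R(u_h)=P(u_h)^{1/2}$ (symmetric positive semi-definite root), $\boldsymbol g_j(u_h):=\sum_i(M_{\mathrm G}^{-1}R(u_h))_{ij}\boldsymbol f_i$, $j=1,\dots,n_G$. A weak solution on $[0,T]$ with initial datum $\rho_{0,h}\in V_p$ is a filtered probability space with an $n_G$-dimensional standard Brownian motion $(B_j)$ and a continuous adapted $V_p$-valued process $\rho_h$ with $(\rho_h(t),v_h)=(\rho_{0,h},v_h)-\int_0^ta_h(\rho_h(s),v_h)\mathrm ds+N^{-1/2}\sum_j\int_0^t(\boldsymbol g_j(\rho_h(s)),G_hv_h)\mathrm dB_j(s)$ for all $v_h\in V_p$, $t\in[0,T]$, a.s., and $\mathbb E[\sup_{t\le T}\|\rho_h(t)\|^q]<\infty$ for all $q\ge2$. *)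

(* Defs.v *)
From HB Require Import structures.
From mathcomp Require Import all_boot all_order all_algebra.
From mathcomp Require Import all_classical all_reals all_analysis.
Import Order.TTheory GRing.Theory Num.Theory.
Import numFieldNormedType.Exports.

Set Implicit Arguments.
Unset Strict Implicit.
Unset Printing Implicit Defensive.

Local Open Scope classical_set_scope.
Local Open Scope ring_scope.

(** * Euclidean geometry of simplices *)

Definition dot (R : realType) (d : nat) (x y : 'rV[R]_d) : R :=
  \sum_i x 0 i * y 0 i.

Definition enorm (R : realType) (d : nat) (x : 'rV[R]_d) : R :=
  Num.sqrt (dot x x).

(* Convex hull of those points [a i] of the family [a] with [S i]; a face of
   the simplex with vertices [a], possibly empty. *)
Definition face_hull (R : realType) (d m : nat) (a : 'I_m -> 'rV[R]_d)
    (S : set 'I_m) : set 'rV[R]_d :=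
  [set x | exists c : 'I_m -> R,
    [/\ forall i, 0 <= c i, forall i, ~ S i -> c i = 0,
        \sum_i c i = 1 & x = \sum_i c i *: a i]].

Definition simplex (R : realType) (d m : nat) (a : 'I_m -> 'rV[R]_d) :
  set 'rV[R]_d := face_hull a setT.

Definition edges (R : realType) (d k : nat) (a : 'I_k.+1 -> 'rV[R]_d) :
  'M[R]_(k, d) := \matrix_(i < k) (a (lift ord0 i) - a ord0).

Definition diam (R : realType) (d : nat) (A : set 'rV[R]_d) : R :=
  sup [set r | exists x y, [/\ A x, A y & r = enorm (x - y)]].

(* Diameter of the largest Euclidean ball contained in [A]. *)
Definition inball_diam (R : realType) (d : nat) (A : set 'rV[R]_d) : R :=
  sup [set r | exists2 x, 0 <= r &
    [set y | enorm (y - x) <= r / 2] `<=` A].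

(* Outward unit normal of the simplex with vertices [a] on the facet opposite
   to the vertex [a i]. *)
Definition outward_normal (R : realType) (d : nat) (a : 'I_d.+1 -> 'rV[R]_d)
    (i : 'I_d.+1) : 'rV[R]_d :=
  xget 0 [set n | [/\ enorm n = 1,
    forall j k, j != i -> k != i -> dot n (a j - a k) = 0 &
    forall j, j != i -> dot n (a i - a j) < 0]].

(** * Integration over affine simplices *)

(* Integral over R^k with respect to k-dimensional Lebesgue measure, as an
   iterated one-dimensional Lebesgue integral. *)
Fixpoint iterated_integral (R : realType) (k : nat) :
    ('rV[R]_k -> R) -> R :=
  match k with
  | 0 => fun g => g 0
  | k'.+1 => fun g => \int[@lebesgue_measure R]_x
      iterated_integral (fun y : 'rV[R]_k' => g (row_mx (x%:M : 'rV_1) y))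
  end.

Definition ref_simplex (R : realType) (k : nat) : set 'rV[R]_k :=
  [set t | (forall i, 0 <= t 0 i) /\ \sum_i t 0 i <= 1].

(* Integral of [f] over the simplex with the [m] vertices [a], with respect to
   the (m-1)-dimensional volume: pull-back to the reference simplex, with the
   Gram factor of the affine parametrization.  For [m = d.+1] the Gram factor
   is the absolute value of the Jacobian determinant, so this is the Lebesgue
   integral; for [m = d] it is the surface integral (the value at the point if
   [d = 1]).  The empty simplex has integral 0. *)
Definition simplex_integral (R : realType) (d m : nat) :
    ('I_m -> 'rV[R]_d) -> ('rV[R]_d -> R) -> R :=
  match m with
  | 0 => fun _ _ => 0
  | k.+1 => fun a f =>
      Num.sqrt (\det (edges a *m (edges a)^T)) *
      iterated_integral (fun t : 'rV[R]_k =>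
        \1_(@ref_simplex R k) t * f (a ord0 + t *m edges a))
  end.

(** * Conforming simplicial meshes of the torus (R / L Z)^d *)

Definition lattice_vector (R : realType) (d : nat) (L : R) (z : 'rV[int]_d) :
  'rV[R]_d := \row_i (L * (z 0 i)%:~R).

(* A mesh of the torus is a triangulation of R^d invariant under the lattice
   L Z^d.  Each element [K] of the mesh is given by one representative simplex
   in R^d; the other ones are its lattice translates.  A pair [(K, i)] denotes
   the facet of [K] opposite to its vertex number [i].  Each facet [F] of the
   mesh has two sides, left ([false]) and right ([true]), and [shift F] is the
   lattice translation taking the left representative of [F] to the right one.
   Every facet of every element is exactly one side of exactly one [F]. *)
Record torus_mesh (R : realType) (d : nat) (L : R) := TorusMesh {
  elt : finType;
  fct : finType;
  vtx : elt -> 'I_d.+1 -> 'rV[R]_d;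
  side : fct -> bool -> elt * 'I_d.+1;
  shift : fct -> 'rV[int]_d;
  vtx_free : forall K, row_free (edges (vtx K));
  elt_cover : forall x : 'rV[R]_d, exists K z,
    simplex (vtx K) (x + lattice_vector L z);
  elt_conforming : forall K K' (z : 'rV[int]_d),
    let a' := fun j => vtx K' j + lattice_vector L z in
    simplex (vtx K) `&` simplex a' =
    face_hull (vtx K) [set i | exists j, vtx K i = a' j];
  elt_distinct : forall K K' (z : 'rV[int]_d),
    (forall i, exists j, vtx K i = vtx K' j + lattice_vector L z) -> K = K';
  side_bij : bijective (fun Fb : fct * bool => side Fb.1 Fb.2);
  side_match : forall F,
    range (fun j : 'I_d => vtx (side F true).1 (lift (side F true).2 j)) =
    range (fun j : 'I_d => vtx (side F false).1 (lift (side F false).2 j)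
                           + lattice_vector L (shift F))
}.

Section Mesh.
Variables (R : realType) (d : nat) (L : R) (M : torus_mesh d L).

Definition shape_regular (sigma : R) : Prop :=
  forall K : elt M,
    diam (simplex (vtx K)) <= sigma * inball_diam (simplex (vtx K)).

Definition quasi_uniform (kappa : R) : Prop :=
  forall K K' : elt M,
    diam (simplex (vtx K')) <= kappa * diam (simplex (vtx K)).

(* Vertices of the left representative of a facet.  Functions on [F] are
   functions of a point of this representative. *)
Definition fvtx (F : fct M) (j : 'I_d) : 'rV[R]_d :=
  vtx (side F false).1 (lift (side F false).2 j).

Definition normal (F : fct M) (b : bool) : 'rV[R]_d :=
  outward_normal (vtx (side F b).1) (side F b).2.

Definition facet_integral (F : fct M) (g : 'rV[R]_d -> R) : R :=
  simplex_integral (fvtx F) g.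

(* The function [h_F]. *)
Definition facet_size (hF : fct M -> R) : Prop :=
  (forall F, 0 < hF F) /\
  ((1 < d)%N -> forall F, hF F = diam (simplex (fvtx F))).

(* Integral over the boundary of [K] of the normal component of a vector field
   given on the facets. *)
Definition boundary_flux (K : elt M) (J : fct M -> 'rV[R]_d -> 'rV[R]_d) : R :=
  \sum_(F : fct M) \sum_(b : bool | (side F b).1 == K)
    facet_integral F (fun x => dot (J F x) (normal F b)).

(** * Broken functions *)

(* A function on the torus that is smooth on each element is given by its
   restriction to each representative simplex.  For piecewise polynomials the
   restriction is the polynomial function on all of R^d. *)
Definition broken (W : Type) := elt M -> 'rV[R]_d -> W.

Definition elt_integral (K : elt M) (g : 'rV[R]_d -> R) : R :=
  simplex_integral (vtx K) g.

Definition torus_integral (g : broken R) : R := \sum_K elt_integral K (g K).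

Definition ip (u v : broken R) : R :=
  torus_integral (fun K x => u K x * v K x).

Definition vip (u v : broken 'rV[R]_d) : R :=
  torus_integral (fun K x => dot (u K x) (v K x)).

Definition l2norm (u : broken R) : R := Num.sqrt (ip u u).

(* Polynomial functions of total degree at most [k]. *)
Definition polyfun (k : nat) (f : 'rV[R]_d -> R) : Prop :=
  exists c : {ffun 'I_d -> 'I_k.+1} -> R, forall x,
    f x = \sum_(m : {ffun 'I_d -> 'I_k.+1} | (\sum_i m i <= k)%N)
      c m * \prod_i x 0 i ^+ m i.

Definition dg_space (k : nat) : set (broken R) :=
  [set v | forall K, polyfun k (v K)].

Definition vdg_space (k : nat) : set (broken 'rV[R]_d) :=
  [set v | forall K i, polyfun k (fun x => v K x 0 i)].

Definition bgrad (v : broken R) : broken 'rV[R]_d :=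
  fun K x => \row_i 'D_(delta_mx 0 i) (v K) x.

Definition trace (W : Type) (v : broken W) (F : fct M) (b : bool)
    (x : 'rV[R]_d) : W :=
  v (side F b).1 (if b then x + lattice_vector L (shift F) else x).

Definition avg (v : broken 'rV[R]_d) (F : fct M) (x : 'rV[R]_d) : 'rV[R]_d :=
  2^-1 *: (trace v F false x + trace v F true x).

Definition jump (v : broken R) (F : fct M) (x : 'rV[R]_d) : 'rV[R]_d :=
  trace v F false x *: normal F false + trace v F true x *: normal F true.

(* The local lifting of [u] from [F] into the piecewise polynomial vector
   fields of degree at most [k]; it is unique, by the Riesz theorem. *)
Definition lifting (k : nat) (F : fct M) (u : 'rV[R]_d -> 'rV[R]_d) :
    broken 'rV[R]_d :=
  xget (fun _ _ => 0) [set l | vdg_space k l /\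
    forall v, vdg_space k v ->
      vip l v = facet_integral F (fun x => dot (avg v F x) (u x))].

Definition dg_grad (p : nat) (v : broken R) : broken 'rV[R]_d :=
  fun K x => bgrad v K x - \sum_(F : fct M) lifting p.-1 F (jump v F) K x.

Definition sip_form (eta : R) (hF : fct M -> R) (w v : broken R) : R :=
  2^-1 * vip (bgrad w) (bgrad v)
  - 2^-1 * (\sum_(F : fct M) facet_integral F (fun x =>
       dot (jump w F x) (avg (bgrad v) F x)
       + dot (avg (bgrad w) F x) (jump v F x)))
  + eta / 2 * (\sum_(F : fct M) (hF F)^-1 *
       facet_integral F (fun x => dot (jump w F x) (jump v F x))).

(** * Noise coefficients *)

Definition is_basis (k n : nat) (f : 'I_n -> broken 'rV[R]_d) : Prop :=
  (forall i, vdg_space k (f i)) /\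
  (forall v, vdg_space k v ->
     exists! c : 'rV[R]_n, v = fun K x => \sum_i c 0 i *: f i K x).

Definition psd_sqrt (n : nat) (A : 'M[R]_n) : 'M[R]_n :=
  xget 0 [set B | [/\ B^T = B, forall x : 'rV[R]_n, 0 <= (x *m B *m x^T) 0 0
                    & B *m B = A]].

Definition gram_mx (n : nat) (f : 'I_n -> broken 'rV[R]_d) : 'M[R]_n :=
  \matrix_(i, j) vip (f i) (f j).

Definition weighted_gram_mx (n : nat) (f : 'I_n -> broken 'rV[R]_d)
    (u : broken R) : 'M[R]_n :=
  \matrix_(i, j)
    torus_integral (fun K x => Num.max (u K x) 0 * dot (f i K x) (f j K x)).

Definition noise (n : nat) (f : 'I_n -> broken 'rV[R]_d) (u : broken R)
    (j : 'I_n) : broken 'rV[R]_d :=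
  fun K x => \sum_i
    (invmx (gram_mx f) *m psd_sqrt (weighted_gram_mx f u)) i j *: f i K x.

(** * Numerical fluxes *)

Definition flux_det (eta : R) (hF : fct M -> R) (w : broken R) (F : fct M)
    (x : 'rV[R]_d) : 'rV[R]_d :=
  - (2^-1 *: avg (bgrad w) F x) + (eta / (2 * hF F)) *: jump w F x.

(* Coefficient of dB_j in the stochastic flux. *)
Definition flux_stoch (N n : nat) (f : 'I_n -> broken 'rV[R]_d) (w : broken R)
    (j : 'I_n) (F : fct M) (x : 'rV[R]_d) : 'rV[R]_d :=
  (Num.sqrt N%:R)^-1 *: avg (noise f w j) F x.

End Mesh.

(** * Stochastic calculus on [0, T] *)

Section Stochastic.
Variables (R : realType) (disp : measure_display) (Om : measurableType disp).
Variables (P : probability Om R) (T : R).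
Notation mu := (@lebesgue_measure R).

Definition is_filtration (Fil : R -> set (set Om)) : Prop :=
  [/\ forall t, t \in `[0, T] -> sigma_algebra setT (Fil t),
      forall t, t \in `[0, T] -> Fil t `<=` measurable &
      forall s t, s \in `[0, T] -> t \in `[0, T] -> s <= t ->
        Fil s `<=` Fil t].

Definition measurable_wrt (G : set (set Om)) (X : Om -> R) : Prop :=
  measurable_fun [set: g_sigma_algebraType G] X.

Definition adapted (Fil : R -> set (set Om)) (X : R -> Om -> R) : Prop :=
  forall t, t \in `[0, T] -> measurable_wrt (Fil t) (X t).

Definition progressive (Fil : R -> set (set Om)) (H : R -> Om -> R) : Prop :=
  forall t, t \in `[0, T] ->
    measurable_fun (`[0, t]%classic `*` setT)
      (fun z : R * g_sigma_algebraType (Fil t) => H z.1 z.2).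

(* Standard n-dimensional Brownian motion relative to [Fil].  The last clause
   says at once that the increments over [s, t] are independent of [Fil s],
   mutually independent and centered Gaussian of variance [t - s]. *)
Definition is_brownian (Fil : R -> set (set Om)) (n : nat)
    (B : 'I_n -> R -> Om -> R) : Prop :=
  [/\ forall j, {ae P, forall w, B j 0 w = 0},
      forall j, {ae P, forall w, {within `[0, T], continuous (B j ^~ w)}},
      forall j, adapted Fil (B j) &
      forall s t, 0 <= s -> s < t -> t <= T ->
      forall (A : set Om) (C : 'I_n -> set R),
        Fil s A -> (forall j, measurable (C j)) ->
        P (A `&` [set w | forall j, C j (B j t w - B j s w)]) =
        (P A * \prod_(j < n) normal_prob 0 (Num.sqrt (t - s)) (C j))%E].

(* Simple predictable processes
   \sum_(k < len) coef k * 1_(node k, node k.+1]. *)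
Record simple_process (Fil : R -> set (set Om)) := SimpleProcess {
  sp_len : nat;
  sp_node : nat -> R;
  sp_coef : nat -> Om -> R;
  sp_node_ge0 : 0 <= sp_node 0%N;
  sp_node_le : forall k, (k < sp_len)%N -> sp_node k <= sp_node k.+1;
  sp_node_leT : sp_node sp_len <= T;
  sp_coef_meas : forall k, (k < sp_len)%N ->
    measurable_wrt (Fil (sp_node k)) (sp_coef k);
  sp_coef_bnd : exists C : R, forall k w, (k < sp_len)%N -> `|sp_coef k w| <= C
}.

Definition sp_val Fil (H : simple_process Fil) (s : R) (w : Om) : R :=
  \sum_(k < sp_len H)
    sp_coef H k w * \1_(`]sp_node H k, sp_node H k.+1]%classic) s.

Definition sp_integral Fil (H : simple_process Fil) (B : R -> Om -> R)
    (t : R) (w : Om) : R :=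
  \sum_(k < sp_len H) sp_coef H k w *
    (B (Num.min (sp_node H k.+1) t) w - B (Num.min (sp_node H k) t) w).

Definition cvg0_in_probability (X : nat -> Om -> \bar R) : Prop :=
  forall eps : R, 0 < eps ->
    P [set w | (eps%:E <= X n w)%E] @[n --> \oo] --> 0%E.

(* [I] is (a continuous version of) the Ito integral process
   t |-> \int_0^t H dB on [0, T], for H progressively measurable and almost
   surely square integrable in time: the limit in probability of the integrals
   of simple processes approximating H in L^2(0, T), in probability.  This
   determines [I] up to indistinguishability. *)
Definition is_ito_integral (Fil : R -> set (set Om)) (B H I : R -> Om -> R) :
    Prop :=
  [/\ progressive Fil H,
      {ae P, forall w, (\int[mu]_(s in `[0%R, T]) ((H s w) ^+ 2)%:E < +oo)%E},
      forall t, t \in `[0, T] -> measurable_fun setT (I t),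
      forall w, {within `[0, T], continuous (I ^~ w)} &
      exists Hn : nat -> simple_process Fil,
        cvg0_in_probability (fun n w =>
          \int[mu]_(s in `[0%R, T]) ((sp_val (Hn n) s w - H s w) ^+ 2)%:E)%E /\
        forall t, t \in `[0, T] ->
          cvg0_in_probability
            (fun n w => `|sp_integral (Hn n) B t w - I t w|%:E)].

(* X t = X0 + \int_0^t a ds + \sum_j \int_0^t b_j dB_j for all t in [0, T],
   almost surely, all integrals being well defined.  For [X0 = X 0] this is
   the meaning of dX = a dt + \sum_j b_j dB_j. *)
Definition is_ito_process (Fil : R -> set (set Om)) (n : nat)
    (B : 'I_n -> R -> Om -> R) (X0 : Om -> R) (X a : R -> Om -> R)
    (b : 'I_n -> R -> Om -> R) : Prop :=
  {ae P, forall w, mu.-integrable `[0, T] (EFin \o (a ^~ w))} /\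
  exists I : 'I_n -> R -> Om -> R,
    (forall j, is_ito_integral Fil (B j) (b j) (I j)) /\
    {ae P, forall w, forall t, t \in `[0, T] ->
      X t w = X0 w + \int[mu]_(s in `[0, t]) a s w + \sum_j I j t w}.

End Stochastic.

(** * Weak solutions of the discontinuous Galerkin Dean-Kawasaki scheme *)

(* Since the space of piecewise polynomials is finite dimensional, adaptedness
   of rho amounts to that of all its inner products. *)
Definition is_weak_solution (R : realType) (d : nat) (L : R)
    (M : torus_mesh d L) (p : nat) (eta : R) (hF : fct M -> R) (N n : nat)
    (f : 'I_n -> broken M 'rV[R]_d) (T : R) (rho0 : broken M R)
    (disp : measure_display) (Om : measurableType disp) (P : probability Om R)
    (Fil : R -> set (set Om)) (B : 'I_n -> R -> Om -> R)
    (rho : R -> Om -> broken M R) : Prop :=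
  [/\ is_filtration T Fil /\ is_brownian P T Fil B,
      forall t w, t \in `[0, T] -> dg_space p (rho t w),
      (forall v, dg_space p v -> adapted T Fil (fun t w => ip (rho t w) v)) /\
      (forall w t, t \in `[0, T] ->
         l2norm (rho s w \- rho t w) @[s --> within `[0, T] (nbhs t)] --> 0),
      forall v, dg_space p v ->
        is_ito_process P T Fil B
          (fun=> ip rho0 v)
          (fun t w => ip (rho t w) v)
          (fun t w => - sip_form eta hF (rho t w) v)
          (fun j t w =>
             (Num.sqrt N%:R)^-1 * vip (noise f (rho t w) j) (dg_grad p v)) &
      forall q : R, 2 <= q ->
        (\int[P]_w ereal_sup
           [set ((l2norm (rho t w)) `^ q)%:E | t in `[0%R, T]] < +oo)%E].

(* Main.v *)
Require Import Defs.
From mathcomp Require Import all_boot all_order all_algebra.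
From mathcomp Require Import all_classical all_reals all_analysis.
From mathcomp Require Import measurable_realfun ring.
Import Order.TTheory GRing.Theory Num.Theory.
Import numFieldNormedType.Exports.

Set Implicit Arguments.
Unset Strict Implicit.
Unset Printing Implicit Defensive.

Local Open Scope classical_set_scope.
Local Open Scope ring_scope.

(** Take the indicator function of K as the test function of the scheme.  It is
    a broken polynomial of degree 0, so it is admissible, and pairing with it
    turns the inner product into the integral over K.  Its broken gradient
    vanishes, and its jump on a facet is the sum of the outward normals of
    those sides of the facet that belong to K.  Hence the volume term and the
    term with the average of its gradient drop out of the interior penalty
    form, and what remains is the boundary flux of the deterministic numerical
    flux ([sip_form_elt_indic]).  Likewise its discrete gradient is minus the
    sum of the liftings of its jumps, and the defining identity of the liftings,
    applied to a noise field, yields the boundary flux of the average of this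
    field ([vip_noise_dg_grad_elt_indic]).

    Both computations regroup sums under integral signs, so they need the
    integrals over elements and facets to be additive.  These are iterated
    one-dimensional integrals of a polynomial times the indicator function of
    the reference simplex; additivity requires each partial integral to be
    integrable, which follows from joint measurability and a bound with
    compact support ([slice_integral_integrable]).

    The defining identity of a lifting is available only if a lifting exists.
    As the space is finite dimensional, this reduces to the invertibility of
    the Gram matrix of a basis ([gram_mx_unit]), that is, to the fact that a
    broken polynomial field of norm zero vanishes.  The latter holds because a
    nonnegative polynomial with zero integral over a simplex vanishes on an
    open set, hence everywhere ([full_simplex_integral_eq0]).

    Finally the scheme starts from the integral of the initial datum, whereas
    the balance on K starts from the integral of the solution at time 0.  They
    agree almost surely because Ito integrals vanish at time 0
    ([ito_integral_at0]). *)

(** * Polynomial functions *)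

(** Inductive generation, without reference to degrees or coefficients, makes
    each closure property and each regularity property of polynomial functions
    an induction with four cases. *)
Inductive is_poly (R : realType) (k : nat) : ('rV[R]_k -> R) -> Prop :=
| is_poly_cst c : is_poly (fun=> c)
| is_poly_coord i : is_poly (fun x => x 0 i)
| is_polyD f g : is_poly f -> is_poly g -> is_poly (fun x => f x + g x)
| is_polyM f g : is_poly f -> is_poly g -> is_poly (fun x => f x * g x).

Lemma eq_is_poly (R : realType) k (f g : 'rV[R]_k -> R) :
  f =1 g -> is_poly f -> is_poly g.
Proof. by move=> /funext ->. Qed.

Lemma is_polyZ (R : realType) k (c : R) (f : 'rV[R]_k -> R) :
  is_poly f -> is_poly (fun x => c * f x).
Proof. by move=> pf; apply: is_polyM => //; exact: is_poly_cst. Qed.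

Lemma is_polyN (R : realType) k (f : 'rV[R]_k -> R) :
  is_poly f -> is_poly (fun x => - f x).
Proof.
by move=> /(is_polyZ (-1)); apply: eq_is_poly => x; rewrite mulN1r.
Qed.

Lemma is_poly_sum (R : realType) k (I : Type) (s : seq I) (Q : pred I)
    (F : I -> 'rV[R]_k -> R) :
  (forall i, Q i -> is_poly (F i)) ->
  is_poly (fun x => \sum_(i <- s | Q i) F i x).
Proof.
move=> pF; elim: s => [|i s IH].
  by apply: eq_is_poly (@is_poly_cst R k 0) => x; rewrite big_nil.
case: (boolP (Q i)) => Qi.
  by apply: eq_is_poly (is_polyD (pF i Qi) IH) => x; rewrite big_cons Qi.
by apply: eq_is_poly IH => x; rewrite big_cons (negbTE Qi).
Qed.

Lemma is_poly_prod (R : realType) k (I : Type) (s : seq I)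
    (F : I -> 'rV[R]_k -> R) :
  (forall i, is_poly (F i)) -> is_poly (fun x => \prod_(i <- s) F i x).
Proof.
move=> pF; elim: s => [|i s IH].
  by apply: eq_is_poly (@is_poly_cst R k 1) => x; rewrite big_nil.
by apply: eq_is_poly (is_polyM (pF i) IH) => x; rewrite big_cons.
Qed.

Lemma is_polyX (R : realType) k (f : 'rV[R]_k -> R) n :
  is_poly f -> is_poly (fun x => f x ^+ n).
Proof.
move=> pf; elim: n => [|n IH]; first exact: is_poly_cst.
by apply: eq_is_poly (is_polyM pf IH) => x; rewrite exprS.
Qed.

Lemma polyfun_is_poly (R : realType) d k (f : 'rV[R]_d -> R) :
  polyfun k f -> is_poly f.
Proof.
move=> [c fE]; rewrite (funext fE); apply: is_poly_sum => m _.
apply: is_polyZ; apply: is_poly_prod => i; apply: is_polyX.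
exact: is_poly_coord.
Qed.

Lemma is_poly_comp (R : realType) d k (f : 'rV[R]_d -> R)
    (h : 'rV[R]_k -> 'rV[R]_d) :
  is_poly f -> (forall i, is_poly (fun t => h t 0 i)) ->
  is_poly (fun t => f (h t)).
Proof.
move=> pf ph; elim: pf => [c|i|f1 f2 _ p1 _ p2|f1 f2 _ p1 _ p2].
- exact: is_poly_cst.
- exact: ph.
- exact: is_polyD.
- exact: is_polyM.
Qed.

Lemma is_poly_affine (R : realType) d k (f : 'rV[R]_d -> R) (a : 'rV[R]_d)
    (E : 'M[R]_(k, d)) :
  is_poly f -> is_poly (fun t => f (a + t *m E)).
Proof.
move=> pf; apply: is_poly_comp => // i.
apply: (@eq_is_poly _ _ (fun t => a 0 i + \sum_j t 0 j * E j i)).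
  by move=> t; rewrite !mxE.
apply: is_polyD; first exact: is_poly_cst.
apply: is_poly_sum => j _; apply: is_polyM; first exact: is_poly_coord.
exact: is_poly_cst.
Qed.

Lemma is_poly_translate (R : realType) d (f : 'rV[R]_d -> R) (a : 'rV[R]_d) :
  is_poly f -> is_poly (fun x => f (x + a)).
Proof.
move=> /(is_poly_affine a 1%:M); apply: eq_is_poly => x.
by rewrite mulmx1 addrC.
Qed.

Lemma is_poly_dot (R : realType) k d (u v : 'rV[R]_k -> 'rV[R]_d) :
  (forall i, is_poly (fun x => u x 0 i)) ->
  (forall i, is_poly (fun x => v x 0 i)) ->
  is_poly (fun x => dot (u x) (v x)).
Proof. by move=> pu pv; apply: is_poly_sum => i _; exact: is_polyM. Qed.

Lemma is_poly_continuous (R : realType) k (f : 'rV[R]_k -> R) :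
  is_poly f -> continuous f.
Proof.
elim=> [c|i|f1 f2 _ p1 _ p2|f1 f2 _ p1 _ p2] x.
- exact: cst_continuous.
- exact: coord_continuous.
- exact: (cvgD (p1 x) (p2 x)).
- exact: (cvgM (p1 x) (p2 x)).
Qed.

(** Derivability is carried along in the induction because the product rule
    for the directional derivative presupposes it. *)
Lemma is_poly_derive (R : realType) k (f : 'rV[R]_k -> R) (v : 'rV[R]_k) :
  is_poly f ->
  (forall x, derivable f x v) /\ is_poly (fun x => 'D_v f x).
Proof.
elim=> [c|i|f1 f2 p1 [d1 D1] p2 [d2 D2]|f1 f2 p1 [d1 D1] p2 [d2 D2]].
- split; first by move=> x; exact: derivable_cst.
  by apply: eq_is_poly (@is_poly_cst R k 0) => x; rewrite derive_cst.
(* a coordinate is an entry of the identity map, whose derivative is v *)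
- have dc (x : 'rV[R]_k) :
      is_derive x v (fun y : 'rV[R]_k => y 0 i) (v 0 i).
    have dx : derivable (id : 'rV[R]_k -> 'rV[R]_k) x v by exact: derivable_id.
    have /derivable_mxP dxi := dx.
    split; first exact: dxi.
    have := derive_mx dx; rewrite derive_id => /matrixP/(_ 0 i).
    by rewrite mxE => ->.
  split; first by move=> x; have [] := dc x.
  by apply: eq_is_poly (@is_poly_cst R k (v 0 i)) => x; have [] := dc x.
- split; first by move=> x; exact: derivableD.
  by apply: eq_is_poly (is_polyD D1 D2) => x; rewrite -deriveD.
- split; first by move=> x; exact: derivableM.
  apply: eq_is_poly (is_polyD (is_polyM p1 D2) (is_polyM p2 D1)) => x.
  by rewrite -[RHS]/('D_v (f1 * f2) x) deriveM.
Qed.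

Lemma is_poly_bounded (R : realType) k (f : 'rV[R]_k -> R) :
  is_poly f ->
  exists C, forall x : 'rV[R]_k, (forall i, 0 <= x 0 i <= 1) -> `|f x| <= C.
Proof.
elim=> [c|i|f1 f2 _ [C1 b1] _ [C2 b2]|f1 f2 _ [C1 b1] _ [C2 b2]].
- by exists `|c|.
- by exists 1 => x /(_ i) /andP[x0 x1]; rewrite ger0_norm.
- exists (C1 + C2) => x xb.
  by rewrite (le_trans (ler_normD _ _))// lerD ?b1 ?b2.
- exists (C1 * C2) => x xb.
  by rewrite normrM ler_pM ?b1 ?b2.
Qed.

(** On a line a polynomial function is a polynomial in one variable, which has
    finitely many zeros unless it is zero. *)
Lemma is_poly_line (R : realType) k (f : 'rV[R]_k -> R) (x v : 'rV[R]_k) :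
  is_poly f -> exists q : {poly R}, forall s, f (x + s *: v) = q.[s].
Proof.
elim=> [c|i|f1 f2 _ [q1 e1] _ [q2 e2]|f1 f2 _ [q1 e1] _ [q2 e2]].
- by exists c%:P => s; rewrite hornerC.
- exists ((x 0 i)%:P + v 0 i *: 'X) => s.
  by rewrite !mxE !hornerE mulrC.
- by exists (q1 + q2) => s; rewrite hornerD e1 e2.
- by exists (q1 * q2) => s; rewrite hornerM e1 e2.
Qed.

(** On the line from a to any given point, f is a polynomial in one variable
    that vanishes on an interval around the parameter of a. *)
Lemma is_poly_identity (R : realType) k (f : 'rV[R]_k -> R) (a : 'rV[R]_k)
    (r : R) :
  is_poly f -> 0 < r ->
  (forall t : 'rV[R]_k, (forall i, `|t 0 i - a 0 i| < r) -> f t = 0) ->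
  forall t, f t = 0.
Proof.
move=> pf r0 f0 t.
have [q qE] := is_poly_line a (t - a) pf.
suff q0 : q = 0 by have := qE 1; rewrite scale1r addrC subrK q0 horner0.
(* the points a + s j *: (t - a) lie in the box as m bounds every coordinate
   of t - a *)
pose m := 1 + \sum_i `|t 0 i - a 0 i|.
have m0 : 0 < m by rewrite ltr_wpDr// sumr_ge0.
pose s j := r / (m * j.+1%:R).
have qs j : q.[s j] = 0.
  have sj0 : 0 < s j by rewrite divr_gt0// mulr_gt0.
  rewrite -qE; apply: f0 => i.
  rewrite !mxE addrAC subrr add0r normrM gtr0_norm//.
  have ti : `|t 0 i - a 0 i| < m.
    rewrite /m (bigD1 i)//= addrCA ltr_pwDr// ltr_wpDr// sumr_ge0//.
  rewrite /s mulrAC ltr_pdivrMr ?mulr_gt0// ltr_pM2l//.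
  by rewrite (lt_le_trans ti)// ler_peMr ?ler1n// ltW.
apply: (@roots_geq_poly_eq0 _ q [seq s j | j <- iota 0 (size q)]).
- by apply/allP => _ /mapP[j _ ->]; apply/rootP.
- rewrite map_inj_uniq ?iota_uniq// => i j /eqP.
  rewrite /s (inj_eq (mulfI (lt0r_neq0 r0))) (inj_eq invr_inj).
  by rewrite (inj_eq (mulfI (lt0r_neq0 m0))) eqr_nat eqSS => /eqP.
- by rewrite size_map size_iota.
Qed.

(** * Iterated integrals *)

(** Tonelli's theorem provides the measurability for the positive and the
    negative part of the integrand, and the integral is a measurable function
    of these two. *)
Lemma measurable_parametric_integral (R : realType) disp
    (T : measurableType disp) (h : T * R -> R) :
  measurable_fun setT h ->
  measurable_fun setT (fun t => \int[@lebesgue_measure R]_x h (t, x)).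
Proof.
move=> mh.
have mEh : measurable_fun [set: T * R] (EFin \o h) by exact/measurable_EFinP.
apply: (measurableT_comp (@fine_measurable R setT measurableT)).
rewrite (_ : (fun t => _) = fun t =>
  (\int[lebesgue_measure]_x ((EFin \o h)^\+ (t, x)) -
   \int[lebesgue_measure]_x ((EFin \o h)^\- (t, x)))%E); last first.
  apply/funext => t; rewrite integralE.
  by congr (_ - _)%E; apply: eq_integral => x _; rewrite ?funeposE ?funenegE.
apply: emeasurable_funB.
- exact: (@measurable_fun_fubini_tonelli_F _ _ T (measurableTypeR R) R
    lebesgue_measure _ (measurable_funepos mEh) (funepos_ge0 _)).
- exact: (@measurable_fun_fubini_tonelli_F _ _ T (measurableTypeR R) R
    lebesgue_measure _ (measurable_funeneg mEh) (funeneg_ge0 _)).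
Qed.

Lemma Rintegral_indic_itv (R : realType) (a b : R) : a < b ->
  \int[@lebesgue_measure R]_x (\1_(`[a, b]%classic) x : R) = b - a.
Proof.
move=> ab; rewrite /Rintegral integral_indic//= setIT.
have /= -> := @lebesgue_measure_itv R `[a, b].
by rewrite lte_fin ab -EFinB.
Qed.

Definition coordinatewise_measurable (R : realType) disp
    (T : measurableType disp) k (c : T -> 'rV[R]_k) : Prop :=
  forall i, measurable_fun setT (fun t => c t 0 i).

(** Measurability of a function of several variables, tested on all measurable
    families of points.  In contrast to a sigma-algebra on row vectors, this
    passes to slices at a fixed first coordinate by mere substitution. *)
Definition rv_measurable (R : realType) k (F : 'rV[R]_k -> R) : Prop :=
  forall disp (T : measurableType disp) (c : T -> 'rV[R]_k),
    coordinatewise_measurable c -> measurable_fun setT (fun t => F (c t)).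

(** Joint measurability in a parameter and a vector; the parameter is what an
    induction on the dimension needs, as it collects the coordinates that are
    not yet integrated. *)
Definition rv_measurable_family (R : realType) disp (T : measurableType disp)
    k (F : T -> 'rV[R]_k -> R) : Prop :=
  forall disp' (T' : measurableType disp') (u : T' -> T) (c : T' -> 'rV[R]_k),
    measurable_fun setT u -> coordinatewise_measurable c ->
    measurable_fun setT (fun t => F (u t) (c t)).

Lemma coordinatewise_measurable_cons (R : realType) disp
    (T : measurableType disp) k (x : T -> R) (c : T -> 'rV[R]_k) :
  measurable_fun setT x -> coordinatewise_measurable c ->
  coordinatewise_measurable (fun t => row_mx (x t)%:M (c t) : 'rV_(1 + k)).
Proof.
move=> mx mc i; case: (split_ordP i) => j ->.
- rewrite (_ : (fun t => _) = x) //; apply/funext => t.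
  by rewrite row_mxEl mxE ord1 eqxx mulr1n.
- rewrite (_ : (fun t => _) = fun t => c t 0 j) //.
  by apply/funext => t; rewrite row_mxEr.
Qed.

(** Integrating out the first coordinate turns it from a part of the parameter
    into a bound variable, so the induction is on the number of coordinates for
    all parameter spaces at once. *)
Lemma measurable_iterated_integral (R : realType) k disp
    (T : measurableType disp) (F : T -> 'rV[R]_k -> R) :
  rv_measurable_family F ->
  measurable_fun setT (fun t => iterated_integral (F t)).
Proof.
elim: k disp T F => [|k IH] disp T F mF /=.
  by apply: mF => // -[].
apply: (@measurable_parametric_integral _ _ _ (fun z : T * R =>
  iterated_integral (fun y : 'rV[R]_k => F z.1 (row_mx z.2%:M y)))).
apply: IH => disp' T' u c mu mc.
apply: (mF _ _ (fun t => (u t).1)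
  (fun t => row_mx (u t).2%:M (c t) : 'rV_(1 + k))).
  exact: measurableT_comp.
apply: coordinatewise_measurable_cons => //.
exact: measurableT_comp.
Qed.

Definition unit_box (R : realType) k : set 'rV[R]_k :=
  [set t | forall i, 0 <= t 0 i <= 1].

(** Boundedness and support in the unit box are stated as one inequality, which
    is inherited by slices through [unit_box_cons]. *)
Definition box_function (R : realType) k (F : 'rV[R]_k -> R) : Prop :=
  rv_measurable F /\
  exists C, forall t, `|F t| <= C * \1_(@unit_box R k) t.

Lemma unit_box_cons (R : realType) k (x : R) (y : 'rV[R]_k) :
  \1_(@unit_box R (1 + k)) (row_mx x%:M y) =
  \1_(`[0, 1]%classic) x * \1_(@unit_box R k) y :> R.
Proof.
rewrite !indicE -natrM mulnb; congr (_ %:R); congr nat_of_bool.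
apply/idP/idP => [/set_mem xy|/andP[/set_mem x01 /set_mem y01]].
  apply/andP; split; apply/mem_set => /=.
    by rewrite in_itv/=; have := xy (lshift k 0); rewrite row_mxEl mxE mulr1n.
  by move=> i; have := xy (rshift 1 i); rewrite row_mxEr.
apply/mem_set => i; case: (split_ordP i) => j ->; last by rewrite row_mxEr.
by rewrite row_mxEl mxE ord1 mulr1n; move: x01; rewrite /= in_itv.
Qed.

Lemma box_function_slice (R : realType) k (F : 'rV[R]_(1 + k) -> R) (x : R) :
  box_function F -> box_function (fun y : 'rV[R]_k => F (row_mx x%:M y)).
Proof.
move=> [mF [C hC]]; split.
  move=> disp T c mc; apply: (mF _ _ (fun t => row_mx x%:M (c t))).
  exact: coordinatewise_measurable_cons.
exists (C * \1_(`[0, 1]%classic) x) => y.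
by rewrite -mulrA -unit_box_cons.
Qed.

Lemma slice_integral_measurable (R : realType) k (F : 'rV[R]_(1 + k) -> R) :
  rv_measurable F ->
  measurable_fun setT (fun x : R =>
    iterated_integral (fun y : 'rV[R]_k => F (row_mx x%:M y))).
Proof.
move=> mF; apply: (@measurable_iterated_integral R k _ R (fun x y =>
  F (row_mx x%:M y))) => disp T u c mu mc.
apply: (mF _ _ (fun t => row_mx (u t)%:M (c t))).
exact: coordinatewise_measurable_cons.
Qed.

(** The constant does not grow with the dimension because the box has side
    length 1; so the same bound serves every partial integral. *)
Lemma iterated_integral_bound (R : realType) k (F : 'rV[R]_k -> R) (C : R) :
  rv_measurable F -> (forall t, `|F t| <= C * \1_(@unit_box R k) t) ->
  `|iterated_integral F| <= C.
Proof.
elim: k F C => [|k IH] F C mF hC /=.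
  apply: (le_trans (hC 0)); rewrite indicE mem_set ?mulr1//.
  by case.
set h := fun x => iterated_integral _.
have mh : measurable_fun setT h by exact: slice_integral_measurable.
have hb x : `|h x| <= C * \1_(`[0, 1]%classic) x.
  apply: IH => [|y]; last by rewrite -mulrA -unit_box_cons.
  by case: (@box_function_slice R k F x) => //; split => //; exists C.
have iC : lebesgue_measure.-integrable setT
    (EFin \o (fun x : R => C * \1_(`[0, 1]%classic) x)).
  exact: (integrableZl measurableT _ (integrable_indic_itv 0 1 true false)).
have ih : lebesgue_measure.-integrable setT (EFin \o h).
  apply: le_integrable iC => //; first exact/measurable_EFinP.
  by move=> x _ /=; rewrite lee_fin (le_trans (hb x))// ler_norm.
apply: (le_trans (le_normr_Rintegral _ ih)) => //.
apply: (@le_trans _ _ (\int[lebesgue_measure]_x (C * \1_(`[0, 1]%classic) x))).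
  by apply: le_Rintegral => //; exact: integrable_norm.
rewrite RintegralZl//; last first.
  exact: (integrable_indic_itv 0 1 true false).
by rewrite Rintegral_indic_itv// subr0 mulr1.
Qed.

(** This is the integrability that linearity and monotonicity of iterated
    integrals rest on, one dimension at a time. *)
Lemma slice_integral_integrable (R : realType) k (F : 'rV[R]_(1 + k) -> R) :
  box_function F ->
  lebesgue_measure.-integrable setT (EFin \o (fun x : R =>
    iterated_integral (fun y : 'rV[R]_k => F (row_mx x%:M y)))).
Proof.
move=> bF; have [mF [C hC]] := bF.
have iC : lebesgue_measure.-integrable setT
    (EFin \o (fun x : R => C * \1_(`[0, 1]%classic) x)).
  exact: (integrableZl measurableT _ (integrable_indic_itv 0 1 true false)).
apply: le_integrable iC => //.
  by apply/measurable_EFinP; exact: slice_integral_measurable.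
move=> x _ /=; rewrite lee_fin (le_trans _ (ler_norm _))//.
apply: iterated_integral_bound => [|y].
  by have [] := box_function_slice x bF.
by rewrite -mulrA -unit_box_cons.
Qed.

Lemma iterated_integral0 (R : realType) k :
  iterated_integral (fun _ : 'rV[R]_k => 0) = 0.
Proof.
elim: k => [//|k IH] /=.
by rewrite IH Rintegral_cst// mul0r.
Qed.

Lemma iterated_integralD (R : realType) k (F G : 'rV[R]_k -> R) :
  box_function F -> box_function G ->
  iterated_integral (fun t => F t + G t) =
  iterated_integral F + iterated_integral G.
Proof.
elim: k F G => [//|k IH] F G bF bG /=.
rewrite -RintegralD//; [|exact: slice_integral_integrable..].
apply: eq_Rintegral => x _.
by rewrite IH//; exact: box_function_slice.
Qed.

Lemma iterated_integralZ (R : realType) k (a : R) (F : 'rV[R]_k -> R) :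
  box_function F ->
  iterated_integral (fun t => a * F t) = a * iterated_integral F.
Proof.
elim: k F => [//|k IH] F bF /=.
rewrite -RintegralZl//; last exact: slice_integral_integrable.
apply: eq_Rintegral => x _.
by rewrite IH//; exact: box_function_slice.
Qed.

Lemma iterated_integral_ge0 (R : realType) k (F : 'rV[R]_k -> R) :
  (forall t, 0 <= F t) -> 0 <= iterated_integral F.
Proof.
elim: k F => [|k IH] F F0 /=; first exact: F0.
by apply: Rintegral_ge0 => x _; exact: IH.
Qed.

(** The integral is at least c times the volume of the box of radius e
    about a. *)
Lemma iterated_integral_gt0 (R : realType) k (F : 'rV[R]_k -> R)
    (a : 'rV[R]_k) (e c : R) :
  box_function F -> (forall t, 0 <= F t) -> 0 < e -> 0 < c ->
  (forall t : 'rV[R]_k, (forall i, `|t 0 i - a 0 i| <= e) -> c <= F t) ->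
  0 < iterated_integral F.
Proof.
move=> bF F0 e0 c0 cF.
apply: (@lt_le_trans _ _ (c * (2 * e) ^+ k)).
  by rewrite mulr_gt0// exprn_gt0// mulr_gt0.
elim: k F a bF F0 cF => [|k IH] F a bF F0 cF /=.
  by rewrite expr0 mulr1; apply: cF; case.
pose I : set R := `[a 0 0 - e, a 0 0 + e]%classic.
have iI : lebesgue_measure.-integrable setT (EFin \o (\1_I : R -> R)).
  exact: (integrable_indic_itv _ _ true false).
rewrite exprSr mulrA.
have Ie : 2 * e = \int[lebesgue_measure]_x (\1_I x : R).
  by rewrite Rintegral_indic_itv ?ltrD2l ?gtrN//; ring.
rewrite [X in _ * X]Ie -RintegralZl//; apply: le_Rintegral => //.
- exact: (integrableZl measurableT _ iI).
- exact: slice_integral_integrable.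
move=> x _; rewrite indicE; case: (boolP (x \in I)) => [|_]; last first.
  by rewrite mulr0 iterated_integral_ge0.
rewrite mulr1 inE /I/= in_itv/= => /andP[ax xa].
apply: (IH _ (rsubmx (a : 'rV_(1 + k)))) => //.
  exact: box_function_slice.
move=> y ya; apply: cF => i; case: (@split_ordP 1 k i) => j ->.
  rewrite (@row_mxEl R 1 1 k) mxE [j]ord1 mulr1n.
  rewrite (_ : lshift k 0 = 0); last exact/val_inj.
  by rewrite ler_distl ax.
by rewrite (@row_mxEr R 1 1 k); have := ya j; rewrite mxE.
Qed.

(** * Integrals of polynomials over simplices *)

(** The indicator function is a product of indicator functions of half-lines,
    one for each inequality that defines the simplex. *)
Lemma ref_simplex_measurable (R : realType) k :
  rv_measurable (\1_(@ref_simplex R k) : 'rV[R]_k -> R).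
Proof.
move=> disp T c mc.
have mpos : measurable_fun setT (\1_(`[0, +oo[%classic) : R -> R).
  exact: measurable_indic.
pose ind_pos (x : R) : R := \1_(`[0, +oo[%classic) x.
rewrite (_ : (fun t => _) = fun t =>
  (\prod_i ind_pos (c t 0 i)) * ind_pos (1 - \sum_i c t 0 i)).
  apply: measurable_funM.
    by apply: measurable_prod => i _; exact: (measurableT_comp mpos (mc i)).
  apply: (measurableT_comp mpos); apply: measurable_funB => //.
  exact: measurable_sum.
apply/funext => t; rewrite indicE.
have posE x : ind_pos x = (0 <= x)%R%:R.
  by rewrite /ind_pos indicE mem_setE in_itv/= andbT.
under eq_bigr do rewrite posE; rewrite posE subr_ge0.
case: (boolP [forall i, 0 <= c t 0 i]%R) => [/forallP c0|].
  rewrite big1 => [|i _]; last by rewrite c0.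
  rewrite mul1r; congr (nat_of_bool _)%:R; apply/idP/idP => [/set_mem[]//|cs].
  exact/mem_set.
rewrite negb_forall => /existsP[i ci]; rewrite (bigD1 i)//= (negbTE ci) !mul0r.
by rewrite memNset// => -[c0 _]; move: ci; rewrite c0.
Qed.

Lemma ref_simplex_unit_box (R : realType) k :
  @ref_simplex R k `<=` @unit_box R k.
Proof.
move=> t [t0 t1] i; rewrite t0/= (le_trans _ t1)// (bigD1 i)//= lerDl.
exact: sumr_ge0.
Qed.

Lemma is_poly_measurable (R : realType) k (g : 'rV[R]_k -> R) :
  is_poly g -> rv_measurable g.
Proof.
move=> pg disp T c mc.
elim: pg => [a|i|f1 f2 _ m1 _ m2|f1 f2 _ m1 _ m2].
- exact: measurable_cst.
- exact: mc.
- exact: measurable_funD.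
- exact: measurable_funM.
Qed.

Lemma ref_simplex_box_function (R : realType) k (g : 'rV[R]_k -> R) :
  is_poly g -> box_function (fun t => \1_(@ref_simplex R k) t * g t).
Proof.
move=> pg; split.
  move=> disp T c mc; apply: measurable_funM.
    exact: ref_simplex_measurable.
  exact: is_poly_measurable.
have [C gC] := is_poly_bounded pg; exists C => t; rewrite normrM.
have [tS|tS] := pselect (@ref_simplex R k t).
  have tB := ref_simplex_unit_box tS.
  by rewrite !indicE !mem_set// normr1 mul1r mulr1 gC.
rewrite [\1_(@ref_simplex R k) t]indicE memNset// normr0 mul0r.
rewrite mulr_ge0// (le_trans (normr_ge0 (g 0)))// gC// => i.
by rewrite mxE lexx ler01.
Qed.

Lemma simplex_integralD (R : realType) d m (a : 'I_m -> 'rV[R]_d)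
    (f g : 'rV[R]_d -> R) :
  is_poly f -> is_poly g ->
  simplex_integral a (fun x => f x + g x) =
  simplex_integral a f + simplex_integral a g.
Proof.
case: m a => [|k] a pf pg /=; first by rewrite addr0.
rewrite -mulrDr -iterated_integralD; last 2 first.
- exact: ref_simplex_box_function (is_poly_affine _ _ _).
- exact: ref_simplex_box_function (is_poly_affine _ _ _).
by congr (_ * _); congr iterated_integral; apply/funext => t; rewrite mulrDr.
Qed.

Lemma simplex_integralZ (R : realType) d m (a : 'I_m -> 'rV[R]_d)
    (c : R) (f : 'rV[R]_d -> R) :
  is_poly f ->
  simplex_integral a (fun x => c * f x) = c * simplex_integral a f.
Proof.
case: m a => [|k] a pf /=; first by rewrite mulr0.
rewrite mulrCA -[X in _ = _ * X]iterated_integralZ.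
  by congr (_ * _); congr iterated_integral; apply/funext => t; rewrite mulrCA.
exact: ref_simplex_box_function (is_poly_affine _ _ _).
Qed.

Lemma simplex_integral0 (R : realType) d m (a : 'I_m -> 'rV[R]_d) :
  simplex_integral a (fun=> 0) = 0.
Proof.
case: m a => [//|k] a /=; apply/eqP; rewrite mulf_eq0; apply/orP; right.
apply/eqP; rewrite -[RHS](iterated_integral0 R k); congr iterated_integral.
by apply/funext => t; rewrite mulr0.
Qed.

Lemma simplex_integralN (R : realType) d m (a : 'I_m -> 'rV[R]_d)
    (f : 'rV[R]_d -> R) :
  is_poly f -> simplex_integral a (fun x => - f x) = - simplex_integral a f.
Proof.
move=> pf; rewrite -mulN1r -simplex_integralZ//; congr simplex_integral.
by apply/funext => x; rewrite mulN1r.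
Qed.

Lemma simplex_integral_sum (R : realType) d m (a : 'I_m -> 'rV[R]_d)
    (I : Type) (s : seq I) (Q : pred I) (F : I -> 'rV[R]_d -> R) :
  (forall i, is_poly (F i)) ->
  simplex_integral a (fun x => \sum_(i <- s | Q i) F i x) =
  \sum_(i <- s | Q i) simplex_integral a (F i).
Proof.
move=> pF; elim: s => [|i s IH].
  rewrite big_nil -[RHS](simplex_integral0 a); congr simplex_integral.
  by apply/funext => x; rewrite big_nil.
rewrite big_cons; case: ifPn => Qi.
  rewrite -IH -simplex_integralD//; last exact: is_poly_sum.
  by congr simplex_integral; apply/funext => x; rewrite big_cons Qi.
rewrite -IH; congr simplex_integral.
by apply/funext => x; rewrite big_cons (negbTE Qi).
Qed.

Lemma simplex_integral_ge0 (R : realType) d m (a : 'I_m -> 'rV[R]_d)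
    (f : 'rV[R]_d -> R) :
  (forall x, 0 <= f x) -> 0 <= simplex_integral a f.
Proof.
case: m a => [//|k] a f0 /=; apply: mulr_ge0 => //.
by apply: iterated_integral_ge0 => t; rewrite mulr_ge0// indicE.
Qed.

(** By [is_poly_identity], a polynomial that is not zero is nonzero somewhere in
    a given box inside the simplex; by continuity it is bounded below by a
    positive constant near that point, so its integral is positive. *)
Lemma ref_simplex_integral_eq0 (R : realType) k (g : 'rV[R]_k -> R) :
  is_poly g -> (forall t, 0 <= g t) ->
  iterated_integral (fun t => \1_(@ref_simplex R k) t * g t) = 0 ->
  forall t, g t = 0.
Proof.
move=> pg g0 I0.
(* the box of center (r, ..., r) and radius r lies in the simplex: there the
   coordinates are at most 2r = 1/(k+1), so their sum is less than 1 *)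
pose r : R := (2 * k.+1%:R)^-1.
have r0 : 0 < r by rewrite invr_gt0 mulr_gt0.
apply: (@is_poly_identity R k g (const_mx r) r pg r0) => t0 t0r.
apply/eqP/negPn/negP => gt0.
have gp : 0 < g t0 by rewrite lt_neqAle eq_sym gt0 g0.
have boxS (t : 'rV[R]_k) :
    (forall i, `|t 0 i - r| < r) -> @ref_simplex R k t.
  move=> tr.
  have tb i : 0 <= t 0 i <= 2 * r.
    have := tr i; rewrite ltr_distl subrr => /andP[/ltW -> /ltW/=].
    by rewrite mulr_natl mulr2n.
  split=> [i|]; first by have /andP[] := tb i.
  apply: (@le_trans _ _ (\sum_(i < k) 2 * r)).
    by apply: ler_sum => i _; have /andP[] := tb i.
  rewrite sumr_const card_ord -[leLHS]mulr_natr.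
  have -> : 2 * r = k.+1%:R^-1 by rewrite /r invfM mulrA divff ?mul1r.
  by rewrite mulrC ler_pdivrMr// mul1r ler_nat.
have ge : nbhs t0 (fun t => g t0 / 2 < g t /\ forall i, `|t 0 i - r| < r).
  apply: filterI.
    have cg : continuous g := is_poly_continuous pg.
    by apply: (cvgr_gt _ (cg t0)); rewrite ltr_pdivrMr// ltr_pMr// ltr1n.
  apply: (filter_forall (nbhs_filter t0)) => i.
  have cvi := @coord_continuous R 1 k 0 i t0.
  have := t0r i; rewrite mxE ltr_distl subrr => /andP[t0i t0i2].
  apply: filterS (filterI (cvgr_gt _ cvi _ t0i) (cvgr_lt _ cvi _ t0i2)) => t /=.
  by rewrite ltr_distl subrr => -[-> ->].
move: ge => /nbhs_ballP[e /= e0 ge].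
have geB (t : 'rV[R]_k) : (forall i, `|t 0 i - t0 0 i| <= e / 2) ->
    g t0 / 2 < g t /\ forall i, `|t 0 i - r| < r.
  move=> te; apply: ge; split=> // i j.
  rewrite /ball/= ord1 distrC (le_lt_trans (te j))//.
  by rewrite ltr_pdivrMr// ltr_pMr// ltr1n.
suff : 0 < iterated_integral (fun t => \1_(@ref_simplex R k) t * g t).
  by rewrite I0 ltxx.
apply: (@iterated_integral_gt0 _ _ _ t0 (e / 2) (g t0 / 2)) => [|t|||t te].
- exact: ref_simplex_box_function.
- by rewrite mulr_ge0// indicE.
- by rewrite divr_gt0.
- by rewrite divr_gt0.
- have [gt tr] := geB t te.
  by rewrite indicE mem_set ?mul1r ?ltW//; exact: boxS.
Qed.

(** The parametrization of a nondegenerate simplex of full dimension is an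
    affine bijection of the whole space with positive Gram factor, so the claim
    is that on the reference simplex. *)
Lemma full_simplex_integral_eq0 (R : realType) d (a : 'I_d.+1 -> 'rV[R]_d)
    (f : 'rV[R]_d -> R) :
  row_free (edges a) -> is_poly f -> (forall x, 0 <= f x) ->
  simplex_integral a f = 0 -> forall x, f x = 0.
Proof.
move=> Ea pf f0 /= /eqP.
have Eu : edges a \in unitmx by rewrite -row_free_unit.
have detE : \det (edges a) != 0 by rewrite -unitfE -unitmxE.
rewrite mulf_eq0 sqrtr_eq0 det_mulmx det_tr leNgt -expr2.
rewrite exprn_even_gt0// detE/=.
move=> /eqP I0 x.
have := ref_simplex_integral_eq0 (is_poly_affine (a ord0) (edges a) pf)
  (fun t => f0 _) I0 ((x - a ord0) *m invmx (edges a)).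
by rewrite mulmxKV// addrC subrK.
Qed.

(** * Polynomials of bounded degree *)

Lemma polyfun_cst (R : realType) d k (a : R) :
  polyfun k (fun _ : 'rV[R]_d => a).
Proof.
pose m0 : {ffun 'I_d -> 'I_k.+1} := [ffun=> ord0].
exists (fun m => if m == m0 then a else 0) => x.
rewrite (bigD1 m0)/=; last by rewrite big1// => i _; rewrite ffunE.
rewrite eqxx big1 => [|i _]; last by rewrite ffunE expr0.
by rewrite mulr1 big1 ?addr0// => m /andP[_ /negbTE ->]; rewrite mul0r.
Qed.

Lemma polyfunD (R : realType) d k (f g : 'rV[R]_d -> R) :
  polyfun k f -> polyfun k g -> polyfun k (fun x => f x + g x).
Proof.
move=> [c fE] [c' gE]; exists (fun m => c m + c' m) => x.
by rewrite fE gE -big_split/=; apply: eq_bigr => m _; rewrite mulrDl.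
Qed.

Lemma polyfunZ (R : realType) d k (a : R) (f : 'rV[R]_d -> R) :
  polyfun k f -> polyfun k (fun x => a * f x).
Proof.
move=> [c fE]; exists (fun m => a * c m) => x.
by rewrite fE mulr_sumr; apply: eq_bigr => m _; rewrite mulrA.
Qed.

Lemma polyfun_sum (R : realType) d k n (F : 'I_n -> 'rV[R]_d -> R) :
  (forall i, polyfun k (F i)) -> polyfun k (fun x => \sum_i F i x).
Proof.
elim: n F => [|n IH] F pF.
  rewrite (_ : (fun x => _) = fun=> 0); first exact: polyfun_cst.
  by apply/funext => x; rewrite big_ord0.
have := polyfunD (pF ord0) (IH (fun i => F (lift ord0 i)) (fun i => pF _)).
by congr polyfun; apply/funext => x; rewrite big_ord_recl.
Qed.

(** * The Euclidean inner product *)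

Lemma dotC (R : realType) d (x y : 'rV[R]_d) : dot x y = dot y x.
Proof. by apply: eq_bigr => i _; rewrite mulrC. Qed.

Lemma dotDl (R : realType) d (x y z : 'rV[R]_d) :
  dot (x + y) z = dot x z + dot y z.
Proof.
by rewrite /dot -big_split/=; apply: eq_bigr => i _; rewrite mxE mulrDl.
Qed.

Lemma dotZl (R : realType) d (a : R) (x z : 'rV[R]_d) :
  dot (a *: x) z = a * dot x z.
Proof. by rewrite /dot mulr_sumr; apply: eq_bigr => i _; rewrite mxE mulrA. Qed.

Lemma dot0r (R : realType) d (x : 'rV[R]_d) : dot x 0 = 0.
Proof. by rewrite /dot big1// => i _; rewrite mxE mulr0. Qed.

Lemma dotNr (R : realType) d (x y : 'rV[R]_d) : dot x (- y) = - dot x y.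
Proof. by rewrite dotC -scaleN1r dotZl mulN1r dotC. Qed.

Lemma dot_sumr (R : realType) d (I : Type) (s : seq I) (Q : pred I)
    (x : 'rV[R]_d) (y : I -> 'rV[R]_d) :
  dot x (\sum_(i <- s | Q i) y i) = \sum_(i <- s | Q i) dot x (y i).
Proof.
rewrite /dot exchange_big/=; apply: eq_bigr => j _.
by rewrite summxE mulr_sumr.
Qed.

Lemma dot_ge0 (R : realType) d (x : 'rV[R]_d) : 0 <= dot x x.
Proof. by apply: sumr_ge0 => i _; rewrite -expr2 sqr_ge0. Qed.

Lemma dot_eq0 (R : realType) d (x : 'rV[R]_d) : dot x x = 0 -> x = 0.
Proof.
move=> /eqP; rewrite psumr_eq0 => [/allP x0|i _]; last first.
  by rewrite -expr2 sqr_ge0.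
apply/rowP => i; rewrite mxE; apply/eqP.
by have := x0 i; rewrite mem_index_enum mulf_eq0 orbb => /(_ isT).
Qed.

(** * Broken polynomials *)

Section Broken.
Variables (R : realType) (d : nat) (L : R) (M : torus_mesh d L).

Definition broken_poly (v : broken M R) : Prop := forall K, is_poly (v K).

Definition vbroken_poly (v : broken M 'rV[R]_d) : Prop :=
  forall K i, is_poly (fun x => v K x 0 i).

Lemma dg_space_poly k v : @dg_space _ _ _ M k v -> broken_poly v.
Proof. by move=> pv K; exact: polyfun_is_poly (pv K). Qed.

Lemma vdg_space_poly k v : @vdg_space _ _ _ M k v -> vbroken_poly v.
Proof. by move=> pv K i; exact: polyfun_is_poly (pv K i). Qed.

Lemma vdg_space_comb k n (c : 'I_n -> R) (w : 'I_n -> broken M 'rV[R]_d) :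
  (forall i, vdg_space k (w i)) ->
  vdg_space k (fun K x => \sum_i c i *: w i K x).
Proof.
move=> pw K i.
rewrite (_ : (fun x => _) = fun x => \sum_j c j * w j K x 0 i).
  by apply: polyfun_sum => j; exact: polyfunZ (pw j K i).
by apply/funext => x; rewrite summxE; apply: eq_bigr => j _; rewrite mxE.
Qed.

Lemma bgrad_poly v : broken_poly v -> vbroken_poly (bgrad v).
Proof.
move=> pv K i; have [_] := is_poly_derive (delta_mx 0 i) (pv K).
by apply: eq_is_poly => x; rewrite mxE.
Qed.

Lemma trace_poly (W : Type) (g : W -> R) (v : broken M W) F b :
  (forall K, is_poly (fun x => g (v K x))) ->
  is_poly (fun x => g (trace v F b x)).
Proof.
move=> pv; rewrite /trace; case: b => //.
exact: (is_poly_translate _ (pv _)).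
Qed.

Lemma avg_poly v F i :
  vbroken_poly v -> is_poly (fun x => avg v F x 0 i).
Proof.
move=> pv; apply: (@eq_is_poly _ _ (fun x =>
    2^-1 * (trace v F false x 0 i + trace v F true x 0 i))).
  by move=> x; rewrite !mxE.
apply: is_polyZ; apply: is_polyD;
  exact: (trace_poly (g := fun y : 'rV[R]_d => y 0 i)).
Qed.

Lemma jump_poly v F i :
  broken_poly v -> is_poly (fun x => jump v F x 0 i).
Proof.
move=> pv.
have tp b : is_poly (trace v F b) by exact: (trace_poly (g := idfun)).
apply: (@eq_is_poly _ _ (fun x => trace v F false x * normal F false 0 i +
    trace v F true x * normal F true 0 i)).
  by move=> x; rewrite !mxE.
by apply: is_polyD; apply: is_polyM => //; exact: is_poly_cst.
Qed.

(** * The inner product of vector fields *)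

Lemma vipC (u v : broken M 'rV[R]_d) : vip u v = vip v u.
Proof.
apply: eq_bigr => K _; congr simplex_integral.
by apply/funext => x; rewrite dotC.
Qed.

Lemma vip0r (u : broken M 'rV[R]_d) : vip u (fun _ _ => 0) = 0.
Proof.
rewrite /vip /torus_integral big1// => K _.
rewrite -[RHS](simplex_integral0 (vtx K)); congr simplex_integral.
by apply/funext => x; rewrite dot0r.
Qed.

Lemma vipNr u v :
  vbroken_poly u -> vbroken_poly v -> vip u (fun K x => - v K x) = - vip u v.
Proof.
move=> pu pv; rewrite /vip /torus_integral -sumrN; apply: eq_bigr => K _.
rewrite /elt_integral -simplex_integralN; last first.
  exact: (is_poly_dot (pu K) (pv K)).
by congr simplex_integral; apply/funext => x; rewrite dotNr.
Qed.

Lemma vip_sumr (I : finType) u (w : I -> broken M 'rV[R]_d) :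
  vbroken_poly u -> (forall i, vbroken_poly (w i)) ->
  vip u (fun K x => \sum_i w i K x) = \sum_i vip u (w i).
Proof.
move=> pu pw; rewrite /vip /torus_integral exchange_big/=.
apply: eq_bigr => K _; rewrite /elt_integral -simplex_integral_sum.
  by congr simplex_integral; apply/funext => x; rewrite dot_sumr.
by move=> i; exact: (is_poly_dot (pu K) (pw i K)).
Qed.

Lemma vipZr (c : R) u w :
  vbroken_poly u -> vbroken_poly w ->
  vip u (fun K x => c *: w K x) = c * vip u w.
Proof.
move=> pu pw; rewrite /vip /torus_integral mulr_sumr.
apply: eq_bigr => K _; rewrite /elt_integral -simplex_integralZ.
  by congr simplex_integral; apply/funext => x; rewrite dotC dotZl dotC.
exact: (is_poly_dot (pu K) (pw K)).
Qed.

Lemma vip_combr n (c : 'I_n -> R) u (w : 'I_n -> broken M 'rV[R]_d) :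
  vbroken_poly u -> (forall i, vbroken_poly (w i)) ->
  vip u (fun K x => \sum_i c i *: w i K x) = \sum_i c i * vip u (w i).
Proof.
move=> pu pw; rewrite (@vip_sumr _ u (fun i K x => c i *: w i K x))//.
  by apply: eq_bigr => i _; rewrite vipZr.
move=> i K j; apply: eq_is_poly (is_polyZ (c i) (pw i K j)) => x.
by rewrite mxE.
Qed.

Lemma vip_definite v : vbroken_poly v -> vip v v = 0 -> v = fun _ _ => 0.
Proof.
move=> pv /eqP; rewrite psumr_eq0 => [/allP v0|K _]; last first.
  by apply: simplex_integral_ge0 => x; exact: dot_ge0.
apply/funext => K; apply/funext => x.
have /eqP vK : elt_integral K (fun x => dot (v K x) (v K x)) == 0.
  by apply: v0; rewrite mem_index_enum.
apply: dot_eq0; apply: (full_simplex_integral_eq0 (vtx_free K) _ _ vK).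
  exact: (is_poly_dot (pv K) (pv K)).
by move=> y; exact: dot_ge0.
Qed.

(** A row vector c in the kernel is the coordinate vector of a field that is
    orthogonal to the whole basis, hence to itself; by definiteness this field
    is 0, and so is c by uniqueness of coordinates. *)
Lemma gram_mx_unit k n (f : 'I_n -> broken M 'rV[R]_d) :
  is_basis k f -> gram_mx f \in unitmx.
Proof.
move=> [fk fB].
have fp i : vbroken_poly (f i) := vdg_space_poly (fk i).
rewrite -row_free_unit; apply: inj_row_free => c cG0.
pose v : broken M 'rV[R]_d := fun K x => \sum_i c 0 i *: f i K x.
have vk : vdg_space k v by exact: vdg_space_comb.
have vfi i : vip v (f i) = 0.
  rewrite vipC vip_combr//; have /matrixP/(_ 0 i) := cG0; rewrite !mxE.
  by apply: etrans; apply: eq_bigr => j _; rewrite mxE vipC.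
have v0 : v = fun _ _ => 0.
  apply: vip_definite; first exact: vdg_space_poly vk.
  rewrite {2}/v vip_combr//; last exact: vdg_space_poly vk.
  by rewrite big1// => i _; rewrite vfi mulr0.
have [c0 [_ c0_uniq]] := fB _ vk.
rewrite -(c0_uniq c)//; apply: c0_uniq; rewrite v0.
apply/funext => K; apply/funext => x.
by rewrite big1// => i _; rewrite mxE scale0r.
Qed.

(** * Liftings *)

Lemma avg_comb n (c : 'I_n -> R) (w : 'I_n -> broken M 'rV[R]_d) F x :
  avg (fun K y => \sum_i c i *: w i K y) F x = \sum_i c i *: avg (w i) F x.
Proof.
rewrite /avg /trace -big_split/= scaler_sumr; apply: eq_bigr => i _.
by rewrite -scalerDr !scalerA mulrC.
Qed.

Lemma facet_integral_avg_comb n (c : 'I_n -> R) (w : 'I_n -> broken M 'rV[R]_d)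
    F (u : 'rV[R]_d -> 'rV[R]_d) :
  (forall i, vbroken_poly (w i)) -> (forall i, is_poly (fun x => u x 0 i)) ->
  facet_integral F
    (fun x => dot (avg (fun K y => \sum_i c i *: w i K y) F x) (u x)) =
  \sum_i c i * facet_integral F (fun x => dot (avg (w i) F x) (u x)).
Proof.
move=> pw pu.
have pwu i : is_poly (fun x => dot (avg (w i) F x) (u x)).
  by apply: is_poly_dot => // j; exact: avg_poly.
rewrite /facet_integral.
under [RHS]eq_bigr => i _ do rewrite -simplex_integralZ//.
rewrite -simplex_integral_sum => [|i]; last exact: is_polyZ.
congr simplex_integral; apply/funext => x.
rewrite avg_comb dotC dot_sumr; apply: eq_bigr => i _.
by rewrite dotC dotZl.
Qed.

(** Riesz representation in coordinates: the coordinate vector of the lifting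
    solves the linear system with the Gram matrix whose right-hand side lists
    the values of the functional on the basis. *)
Lemma lifting_spec k n (f : 'I_n -> broken M 'rV[R]_d) F
    (u : 'rV[R]_d -> 'rV[R]_d) :
  is_basis k f -> (forall i, is_poly (fun x => u x 0 i)) ->
  vdg_space k (lifting (M := M) k F u) /\
  forall v, vdg_space k v ->
    vip (lifting k F u) v = facet_integral F (fun x => dot (avg v F x) (u x)).
Proof.
move=> fB pu; have [fk fex] := fB.
have fp i : vbroken_poly (f i) := vdg_space_poly (fk i).
pose Phi (v : broken M 'rV[R]_d) :=
  facet_integral F (fun x => dot (avg v F x) (u x)).
pose b := (\row_i Phi (f i)) *m invmx (gram_mx f).
pose l : broken M 'rV[R]_d := fun K x => \sum_i b 0 i *: f i K x.
apply: (@xgetPex _ (fun _ _ => 0) [set l | vdg_space k l /\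
    forall v, vdg_space k v -> vip l v = Phi v]).
have lk : vdg_space k l by exact: vdg_space_comb.
exists l; split => // v /fex[c [-> _]].
have lp := vdg_space_poly lk.
rewrite vip_combr// /Phi facet_integral_avg_comb//; apply: eq_bigr => j _.
congr (_ * _); rewrite vipC vip_combr//.
have : b *m gram_mx f = \row_i Phi (f i).
  by rewrite mulmxKV// (gram_mx_unit fB).
move=> /matrixP/(_ 0 j); rewrite !mxE /Phi => <-.
by apply: eq_bigr => i _; rewrite !mxE vipC.
Qed.

(** * Testing with the indicator function of an element *)

Definition elt_indic (K : elt M) : broken M R := fun K' _ => (K' == K)%:R.

Lemma elt_indic_dg k K : dg_space k (elt_indic K).
Proof. by move=> K'; exact: polyfun_cst. Qed.

Lemma ip_elt_indic (u : broken M R) K :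
  ip u (elt_indic K) = elt_integral K (u K).
Proof.
rewrite /ip /torus_integral (bigD1 K)//= big1 => [|K' /negbTE K'K].
  rewrite addr0; congr simplex_integral; apply/funext => x.
  by rewrite /elt_indic eqxx mulr1.
rewrite -[RHS](simplex_integral0 (vtx K')); congr simplex_integral.
by apply/funext => x; rewrite /elt_indic K'K mulr0.
Qed.

Lemma bgrad_elt_indic K : bgrad (elt_indic K) = fun _ _ => 0.
Proof.
apply/funext => K'; apply/funext => x; apply/rowP => i.
by rewrite !mxE; exact: derive_cst.
Qed.

Lemma jump_elt_indic K F x :
  jump (elt_indic K) F x = \sum_(b | (side F b).1 == K) normal F b.
Proof.
rewrite /jump /trace /elt_indic big_mkcond big_bool/= addrC.
by do 2 case: ifP => _; rewrite ?scale1r ?scale0r.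
Qed.

(** Summing over the sides that belong to K amounts to pairing with the jump of
    the indicator function of K.  If the mesh of a circle has a single element,
    both sides of the facet belong to K, and both contribute. *)
Lemma boundary_fluxE K (J : fct M -> 'rV[R]_d -> 'rV[R]_d) :
  (forall F i, is_poly (fun x => J F x 0 i)) ->
  boundary_flux K J =
  \sum_F facet_integral F (fun x => dot (J F x) (jump (elt_indic K) F x)).
Proof.
move=> pJ; apply: eq_bigr => F _; rewrite /facet_integral.
rewrite -simplex_integral_sum => [|b]; last first.
  by apply: is_poly_dot => // i; exact: is_poly_cst.
by congr simplex_integral; apply/funext => x; rewrite jump_elt_indic dot_sumr.
Qed.

Lemma flux_det_poly eta hF w F i :
  broken_poly w -> is_poly (fun x => flux_det eta hF w F x 0 i).
Proof.
move=> pw; apply: (@eq_is_poly _ _ (fun x =>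
   - (2^-1 * avg (bgrad w) F x 0 i) + eta / (2 * hF F) * jump w F x 0 i)).
  by move=> x; rewrite [in RHS]/flux_det !mxE.
apply: is_polyD; first by apply/is_polyN/is_polyZ/avg_poly/bgrad_poly.
exact/is_polyZ/jump_poly.
Qed.

(** With a vanishing gradient of the test function, only the consistency term
    and the penalty term of the form survive, and they are linear in its
    jump. *)
Lemma sip_form_elt_indic eta hF w K :
  broken_poly w ->
  sip_form eta hF w (elt_indic K) = boundary_flux K (flux_det eta hF w).
Proof.
move=> pw; rewrite boundary_fluxE; last by move=> F i; exact: flux_det_poly.
rewrite /sip_form bgrad_elt_indic vip0r mulr0 sub0r -mulrN -sumrN !mulr_sumr.
rewrite -big_split/=; apply: eq_bigr => F _.
have pj i : is_poly (fun x => jump (elt_indic K) F x 0 i).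
  exact/jump_poly/dg_space_poly/(elt_indic_dg 0).
have pa : is_poly (fun x => dot (avg (bgrad w) F x) (jump (elt_indic K) F x)).
  by apply: is_poly_dot => // i; exact/avg_poly/bgrad_poly.
have pjj : is_poly (fun x => dot (jump w F x) (jump (elt_indic K) F x)).
  by apply: is_poly_dot => // i; exact: jump_poly.
rewrite (_ : (fun x => _ + _) =
    fun x => dot (avg (bgrad w) F x) (jump (elt_indic K) F x)); last first.
  apply/funext => x.
  by rewrite [X in dot _ X + _]/avg /trace addr0 scaler0 dot0r add0r.
rewrite (_ : (fun x => dot (flux_det _ _ _ _ _) _) = fun x =>
    - 2^-1 * dot (avg (bgrad w) F x) (jump (elt_indic K) F x) +
    eta / (2 * hF F) * dot (jump w F x) (jump (elt_indic K) F x)); last first.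
  by apply/funext => x; rewrite /flux_det dotDl -scaleNr !dotZl.
rewrite /facet_integral simplex_integralD; [|exact: is_polyZ..].
by rewrite !simplex_integralZ// mulrN mulNr invfM !mulrA.
Qed.

(** The discrete gradient of the indicator function consists of liftings only,
    and the lifting identity moves the jump from the volume to the facets. *)
Lemma vip_dg_grad_elt_indic p n (f : 'I_n -> broken M 'rV[R]_d)
    (g : broken M 'rV[R]_d) K :
  is_basis p.-1 f -> vdg_space p.-1 g ->
  vip g (dg_grad p (elt_indic K)) = - boundary_flux K (avg g).
Proof.
move=> fB gp.
have pjump F i : is_poly (fun x => jump (elt_indic K) F x 0 i).
  exact/jump_poly/dg_space_poly/(elt_indic_dg 0).
have lift F := lifting_spec F fB (pjump F).
have liftp F := vdg_space_poly (lift F).1.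
rewrite (_ : dg_grad p _ = fun K' x =>
    - \sum_F lifting p.-1 F (jump (elt_indic K) F) K' x); last first.
  apply/funext => K'; apply/funext => x.
  by rewrite /dg_grad bgrad_elt_indic sub0r.
have pg := vdg_space_poly gp.
rewrite vipNr//; last first.
  move=> K' i; apply: (@eq_is_poly _ _ (fun x =>
      \sum_F lifting p.-1 F (jump (elt_indic K) F) K' x 0 i)).
    by move=> x; rewrite summxE.
  by apply: is_poly_sum => F _; exact: liftp.
rewrite vip_sumr// boundary_fluxE; last by move=> F i; exact: avg_poly.
by congr (- _); apply: eq_bigr => F _; rewrite vipC (lift F).2.
Qed.

Lemma boundary_fluxZ (c : R) K (J : fct M -> 'rV[R]_d -> 'rV[R]_d) :
  (forall F i, is_poly (fun x => J F x 0 i)) ->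
  boundary_flux K (fun F x => c *: J F x) = c * boundary_flux K J.
Proof.
move=> pJ; rewrite /boundary_flux mulr_sumr; apply: eq_bigr => F _.
rewrite mulr_sumr; apply: eq_bigr => b _.
rewrite /facet_integral -simplex_integralZ; last first.
  by apply: is_poly_dot => // i; exact: is_poly_cst.
by congr simplex_integral; apply/funext => x; rewrite dotZl.
Qed.

Lemma vip_noise_dg_grad_elt_indic p n (f : 'I_n -> broken M 'rV[R]_d) N u j K :
  is_basis p.-1 f ->
  (Num.sqrt N%:R)^-1 * vip (noise f u j) (dg_grad p (elt_indic K)) =
  - boundary_flux K (flux_stoch N f u j).
Proof.
move=> fB; have noisep : vdg_space p.-1 (noise f u j).
  by apply: vdg_space_comb => i; have [] := fB.
rewrite (vip_dg_grad_elt_indic _ fB noisep) mulrN -boundary_fluxZ// => F i.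
exact/avg_poly/vdg_space_poly/noisep.
Qed.

End Broken.

(** * Ito processes *)

Section Ito.
Variables (R : realType) (disp : measure_display) (Om : measurableType disp).
Variables (P : probability Om R) (T : R) (Fil : R -> set (set Om)).

Lemma sp_node_nonneg (H : simple_process T Fil) k :
  (k <= sp_len H)%N -> 0 <= sp_node H k.
Proof.
elim: k => [|k IH] kH; first exact: sp_node_ge0.
by rewrite (le_trans (IH (ltnW kH)))// sp_node_le.
Qed.

Lemma sp_integral_at0 (H : simple_process T Fil) (B : R -> Om -> R) w :
  sp_integral H B 0 w = 0.
Proof.
rewrite /sp_integral big1// => k _.
by rewrite !min_r ?subrr ?mulr0// sp_node_nonneg// ltnW.
Qed.

(** The nodes of a simple process are nonnegative, so the integrals of the
    approximating simple processes are identically 0 at time 0, and so is their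
    limit in probability. *)
Lemma ito_integral_at0 (B H I : R -> Om -> R) :
  0 <= T -> is_ito_integral P T Fil B H I -> {ae P, forall w, I 0 w = 0}.
Proof.
move=> T0 [_ _ mI _ [Hn [_ cvgI]]].
have T00 : 0 \in `[0, T] by rewrite in_itv/= lexx.
have mI0 := mI 0 T00.
have large0 (e : R) : 0 < e -> P [set w | (e%:E <= `|I 0 w|%:E)%E] = 0%E.
  move=> e0; have := cvgI 0 T00 e e0.
  rewrite (_ : (fun n => _) = cst (P [set w | (e%:E <= `|I 0 w|%:E)%E])).
    by move=> /cvg_lim <-//; rewrite lim_cst.
  apply/funext => n /=; congr (P _); apply/funext => w /=.
  by rewrite sp_integral_at0 sub0r normrN.
apply: (@negligibleS _ _ _ _
    (\bigcup_n [set w | ((n.+1%:R^-1 : R)%:E <= `|I 0 w|%:E)%E])).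
  (* a nonzero |I 0 w| exceeds 1/(n+1) for n the integer part of its inverse *)
  move=> w /= /eqP Iw; exists (Num.truncn `|I 0 w|^-1) => //=.
  rewrite lee_fin -[leRHS]invrK lef_pV2 ?posrE ?invr_gt0 ?normr_gt0//.
  by rewrite ltW// Num.Theory.truncnS_gt.
apply: negligible_bigcup => k; apply/negligibleP; last exact: large0.
have := measurableT_comp (@normr_measurable R setT) mI0.
move=> /(_ measurableT `[k.+1%:R^-1, +oo[%classic (measurable_itv _)).
rewrite setTI; congr measurable; apply/seteqP; split=> w /=.
  by rewrite in_itv/= andbT lee_fin.
by rewrite in_itv/= andbT lee_fin.
Qed.

(** At time 0 all integrals vanish, so the prescribed initial value is almost
    surely the value of the process. *)
Lemma is_ito_process_initial n (B : 'I_n -> R -> Om -> R) X0 X a b :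
  0 <= T -> is_ito_process P T Fil B X0 X a b ->
  is_ito_process P T Fil B (X 0) X a b.
Proof.
move=> T0 [ia [I [itoI XE]]]; split=> //; exists I; split=> //.
have I0 : {ae P, forall w, forall j, I j 0 w = 0}.
  apply: (filter_forall (ae_filter_ringOfSetsType P)) => j.
  exact: ito_integral_at0 (itoI j).
move: XE; apply: filterS2 I0 => w Iw Xw t tT.
have T00 : 0 \in `[0, T] by rewrite in_itv/= lexx.
rewrite (Xw t tT) (Xw 0 T00); congr (_ + _ + _).
by rewrite set_itv1 Rintegral_set1 addr0 big1 ?addr0.
Qed.

(** The drift may be changed outside of [0, T]; this matters because a weak
    solution is a broken polynomial only at times in [0, T]. *)
Lemma eq_is_ito_process n (B : 'I_n -> R -> Om -> R) X0 X X' a a' b b' :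
  X =2 X' -> (forall t w, t \in `[0, T] -> a t w = a' t w) ->
  (forall j t w, b j t w = b' j t w) ->
  is_ito_process P T Fil B X0 X a b -> is_ito_process P T Fil B X0 X' a' b'.
Proof.
move=> XX' aa' bb' [ia [I [itoI XE]]].
have -> : b' = b.
  by apply/funext => j; apply/funext => t; apply/funext => w; rewrite bb'.
split.
  apply: filterS ia => w; apply: eq_integrable => // t.
  by rewrite inE/= => tT; rewrite aa'.
exists I; split=> //; apply: filterS XE => w Xw t tT.
rewrite -XX' (Xw t tT); congr (_ + _ + _); apply: eq_Rintegral => s.
rewrite inE/= in_itv/= => /andP[s0 st]; apply: aa'.
by move: tT; rewrite !in_itv/= s0 => /andP[_]; exact: le_trans.
Qed.

End Ito.

(** * Local conservation *)

Theorem proposition4p10 (R : realType) (d p : nat)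
  (hd : (1 <= d <= 3)%N) (hp : (1 <= p)%N)
  (L : R) (hL : 0 < L) (M : torus_mesh d L)
  (sigma kappa : R) (hsigma : shape_regular M sigma)
  (hkappa : quasi_uniform M kappa)
  (hF : fct M -> R) (hhF : facet_size hF)
  (eta : R) (heta : 0 < eta) (N : nat) (hN : (0 < N)%N)
  (nG : nat) (f : 'I_nG -> broken M 'rV[R]_d) (hf : is_basis p.-1 f)
  (T : R) (hT : 0 < T) (rho0 : broken M R) (hrho0 : dg_space p rho0)
  (disp : measure_display) (Om : measurableType disp) (P : probability Om R)
  (Fil : R -> set (set Om)) (B : 'I_nG -> R -> Om -> R)
  (rho : R -> Om -> broken M R)
  (hrho : is_weak_solution p eta hF N f T rho0 P Fil B rho) :
  forall K : elt M,
    is_ito_process P T Fil B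
      (fun w => elt_integral K (rho 0 w K))
      (fun t w => elt_integral K (rho t w K))
      (fun t w => - boundary_flux K (flux_det eta hF (rho t w)))
      (fun j t w => - boundary_flux K (flux_stoch N f (rho t w) j)).
Proof.
move=> K.
have [_ rho_dg _ /(_ _ (elt_indic_dg p K)) itoK _] := hrho.
have rhoE t w : ip (rho t w) (elt_indic K) = elt_integral K (rho t w K).
  exact: ip_elt_indic.
have -> : (fun w => elt_integral K (rho 0 w K)) =
    (fun w => ip (rho 0 w) (elt_indic K)) by apply/funext => w; rewrite rhoE.
have itoK0 := is_ito_process_initial (ltW hT) itoK.
apply: (eq_is_ito_process _ _ _ itoK0) => [t w|t w tT|j t w].
- exact: rhoE.
- by rewrite sip_form_elt_indic//; exact: dg_space_poly (rho_dg t w tT).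
- exact: vip_noise_dg_grad_elt_indic hf.
Qed.
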